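(* Let $p\ge n$, $\alpha>0$, $q<\frac{\alpha}{n+\alpha}$ and let $f$ be a positive function on $S^{n-1}$. If $h_1,h_2$ are positive $C^2$ solutions on $S^{n-1}$ of $h^{1-p}g_{\alpha,q}(Dh)\det(h_{ij}+h\delta_{ij})=f$, then $h_1=h_2$.
   Context: $g_{\alpha,q}(x)=\frac{1}{Z(\alpha,q)}[1-\frac{q}{\alpha}|x|^\alpha]_+^{\frac1q-\frac n\alpha-1}$ ($q\ne0$), $\frac{1}{Z(\alpha,q)}e^{-|x|^\alpha/\alpha}$ ($q=0$), $Z(\alpha,q)$ normalizing $\int g_{\alpha,q}=1$. $h_{ij}$: covariant Hessian on $S^{n-1}$ in an orthonormal frame; $Dh$: Euclidean gradient of the 1-homogeneous extension of $h$, $|Dh|^2=h^2+|\nabla h|^2$. *)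

(* Defs.v *)
From HB Require Import structures.
From mathcomp Require Import all_boot all_order all_algebra.
From mathcomp Require Import all_classical all_reals all_analysis.
Set Implicit Arguments. Unset Strict Implicit. Unset Printing Implicit Defensive.
Import Order.TTheory GRing.Theory Num.Theory.
Import numFieldNormedType.Exports.
Local Open Scope classical_set_scope.
Local Open Scope ring_scope.

Section Defs.
Variable R : realType.
Variable n : nat.

Definition dotv (u v : 'rV[R]_n) : R := \sum_(i < n) u 0 i * v 0 i.
Definition enorm (u : 'rV[R]_n) : R := Num.sqrt (dotv u u).

Definition sphere : set 'rV[R]_n := [set x | enorm x = 1].

Definition hom0 (h : 'rV[R]_n -> R) (x : 'rV[R]_n) : R :=
  h ((enorm x)^-1 *: x).
Definition hom1 (h : 'rV[R]_n -> R) (x : 'rV[R]_n) : R :=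
  enorm x * h ((enorm x)^-1 *: x).

Definition C2_sphere (h : 'rV[R]_n -> R) : Prop :=
  forall x : 'rV[R]_n, x != 0 ->
    differentiable (hom0 h) x /\
    forall v : 'rV[R]_n, differentiable ('D_v (hom0 h)) x /\
      forall w : 'rV[R]_n, {for x, continuous ('D_w ('D_v (hom0 h)))}.

(* covariant Hessian of h on S^{n-1} at x, evaluated on tangent vectors v w
   (= tangential Euclidean Hessian of the 0-homogeneous extension) *)
Definition cov_hess (h : 'rV[R]_n -> R) (x v w : 'rV[R]_n) : R :=
  'D_w ('D_v (hom0 h)) x.

Definition tangent_frame (x : 'rV[R]_n) (E : 'M[R]_(n.-1, n)) : Prop :=
  E *m E^T = 1%:M /\ E *m x^T = 0.

Definition hess_mx (h : 'rV[R]_n -> R) (x : 'rV[R]_n) (E : 'M[R]_(n.-1, n))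
  : 'M[R]_(n.-1) :=
  \matrix_(i, j) (cov_hess h x (row i E) (row j E) + h x * (i == j)%:R).

Definition Dh (h : 'rV[R]_n -> R) (x : 'rV[R]_n) : 'rV[R]_n :=
  \row_(k < n) 'D_(delta_mx 0 k) (hom1 h) x.

Definition gprof (alpha q r : R) : R :=
  if q == 0 then expR (- (r `^ alpha) / alpha)
  else (Num.max (1 - q / alpha * r `^ alpha) 0) `^ (q^-1 - n%:R / alpha - 1).

End Defs.

(* iterated Lebesgue integral over R^k of a nonnegative function of
   the coordinates y 0, ..., y (k-1) *)
Fixpoint iint {R : realType} (k : nat) (F : (nat -> R) -> \bar R) : \bar R :=
  match k with
  | 0 => F (fun _ => 0)
  | k'.+1 => iint k' (fun y =>
      (\int[lebesgue_measure]_(t in [set: R])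
         F (fun j => if j == k' then t else y j))%E)
  end.

Definition Zc {R : realType} (n : nat) (alpha q : R) : R :=
  fine (iint n (fun y => (gprof n alpha q (enorm (\row_(i < n) y i)))%:E)).

Definition gdens {R : realType} (n : nat) (alpha q : R) (x : 'rV[R]_n) : R :=
  (Zc n alpha q)^-1 * gprof n alpha q (enorm x).

(* Main.v *)
(* At a maximum point x0 of h1/h2 on the sphere, with value t, the 0-homogeneous
   function h1 - t h2 attains its maximum 0.  Hence Dh1 = t Dh2 there, and the
   curvature matrices W = (h_ij + h delta_ij) satisfy W1 <= t W2.  If W1 is positive
   definite, then det W1 <= t^(n-1) det W2; since g is strictly decreasing in
   |Dh| where it is positive, and p >= n, having t > 1 would make the left-hand
   side of the equation for h1 smaller at x0 than the one for h2.  Thus h1 <= h2,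
   and symmetrically.

   Convexity is not assumed but follows from det W > 0: W is positive definite
   at a minimum point of h, and it cannot degenerate along a path. *)
Require Import Defs.
From HB Require Import structures.
From mathcomp Require Import all_boot all_order all_algebra.
From mathcomp Require Import all_classical all_reals all_analysis.
From mathcomp Require Import ring lra.
Import Order.TTheory GRing.Theory Num.Theory.
Import numFieldNormedType.Exports.
Local Open Scope classical_set_scope.
Local Open Scope ring_scope.

(** * Quadratic forms and monotonicity of the determinant *)

Definition qform {F : realFieldType} {n : nat} (A : 'M[F]_n) (v : 'rV[F]_n) : F :=
  (v *m A *m v^T) 0 0.

Definition posdef {F : realFieldType} {n : nat} (A : 'M[F]_n) : Prop :=
  forall v, v != 0 -> 0 < qform A v.

Definition schur {F : realFieldType} {n : nat} (A : 'M[F]_(1 + n)) : 'M[F]_n :=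
  drsubmx A - (A 0 0)^-1 *: ((ursubmx A)^T *m ursubmx A).

Lemma sym_block (F : realFieldType) (n : nat) (A : 'M[F]_(1 + n)) :
  A^T = A -> A = block_mx (A 0 0)%:M (ursubmx A) (ursubmx A)^T (drsubmx A).
Proof.
move=> sA; rewrite -[LHS]submxK; congr block_mx.
  apply/matrixP => i j; rewrite !ord1 !mxE eqxx mulr1n.
  by congr (A _ _); apply/val_inj.
by rewrite -{1}sA trmx_ursub.
Qed.

Lemma schur_sym (F : realFieldType) (n : nat) (A : 'M[F]_(1 + n)) :
  A^T = A -> (schur A)^T = schur A.
Proof.
by move=> sA; rewrite /schur linearB linearZ /= trmx_mul trmxK trmx_drsub sA.
Qed.

(** One step of block elimination: the unipotent [P] clears the column below the pivot without
    changing the determinant. *)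
Lemma det_schur (F : realFieldType) (n : nat) (A : 'M[F]_(1 + n)) :
  A^T = A -> A 0 0 != 0 -> \det A = A 0 0 * \det (schur A).
Proof.
move=> sA a0.
pose P : 'M[F]_(1 + n) :=
  block_mx 1%:M 0 (- ((A 0 0)^-1 *: (ursubmx A)^T)) 1%:M.
have dP : \det P = 1 by rewrite det_lblock !det1 mul1r.
rewrite -[LHS]mul1r -dP -det_mulmx [X in P *m X]sym_block// mulmx_block.
rewrite !mul1mx !mul0mx !addr0 mul_mx_scalar scalerN scalerA mulfV//.
rewrite scale1r addNr det_ublock det_scalar expr1; congr (_ * \det _).
by rewrite /schur addrC mulNmx -scalemxAl.
Qed.

(** Completing the square in the first coordinate. *)
Lemma qform_schur (F : realFieldType) (n : nat) (A : 'M[F]_(1 + n)) c y :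
  A^T = A -> A 0 0 != 0 ->
  qform A (row_mx c%:M y) =
  A 0 0 * (c + (A 0 0)^-1 * (y *m (ursubmx A)^T) 0 0) ^+ 2 + qform (schur A) y.
Proof.
move=> sA a0; rewrite /qform /schur mulmxBr mulmxBl.
rewrite -scalemxAr -scalemxAl mulmxA.
rewrite {1}(sym_block F n A sA) mul_row_block tr_row_mx mul_row_col.
set u := ursubmx A; set D := drsubmx A; set a := A 0 0.
have -> : y *m u^T *m u *m y^T = (y *m u^T) *m (y *m u^T)^T.
  by rewrite trmx_mul trmxK !mulmxA.
set s := y *m u^T.
have uy : u *m y^T = s^T by rewrite /s trmx_mul trmxK.
rewrite !mulmxDl tr_scalar_mx -(mulmxA _ u) uy !mul_scalar_mx mul_mx_scalar.
set Y := y *m D *m y^T.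
rewrite (mx11_scalar s) (mx11_scalar Y).
rewrite !tr_scalar_mx -!scalar_mxM -?scalemxAr -?scalemxAl !mxE !eqxx !mulr1n.
by field; exact: a0.
Qed.

(** Induction on the size. For a positive pivot, the form of the Schur complement is the minimum of
    the full form over the first coordinate, so it is monotone in the matrix. The pivots are ordered
    as well, and the determinant is the pivot times the determinant of the Schur complement. *)
Lemma posdef_det_le (F : realFieldType) (n : nat) (A B : 'M[F]_n) :
  A^T = A -> B^T = B -> posdef A -> (forall v, qform A v <= qform B v) ->
  0 < \det A <= \det B.
Proof.
elim: n A B => [|n IH] A B; first by rewrite !det_mx00 ltr01 lexx.
rewrite -[n.+1]/(1 + n)%N in A B * => sA sB pA leAB.
pose e : 'rV[F]_(1 + n) := row_mx 1%:M 0.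
have qe (M : 'M[F]_(1 + n)) : M^T = M -> qform M e = M 0 0.
  move=> sM; rewrite /qform /e {1}(sym_block F n M sM) mul_row_block tr_row_mx.
  rewrite mul_row_col !mul1mx !mul0mx trmx0 mulmx0 !addr0 trmx1 mulmx1.
  by rewrite mxE eqxx mulr1n.
have e0 : e != 0.
  apply/eqP => /matrixP/(_ 0 (lshift n 0)); rewrite row_mxEl !mxE eqxx.
  by move/eqP; rewrite oner_eq0.
have a0 : 0 < A 0 0 by rewrite -qe//; exact: pA.
have ab : A 0 0 <= B 0 0 by rewrite -!qe.
have b0 := lt_le_trans a0 ab.
rewrite !det_schur ?gt_eqF//.
(* The first coordinate that annihilates the square in [qform_schur]. *)
pose c (M : 'M[F]_(1 + n)) (y : 'rV[F]_n) :=
  - ((M 0 0)^-1 * (y *m (ursubmx M)^T) 0 0).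
have qc (M : 'M[F]_(1 + n)) y : M^T = M -> M 0 0 != 0 ->
    qform M (row_mx (c M y)%:M y) = qform (schur M) y.
  by move=> sM m0; rewrite qform_schur// /c addNr expr0n mulr0 add0r.
have /andP[dA dAB] : 0 < \det (schur A) <= \det (schur B).
  apply: IH; rewrite ?schur_sym//.
    move=> y y0; rewrite -qc ?gt_eqF//; apply: pA; apply: contra_neq y0 => y0.
    apply/matrixP => i j; move/matrixP/(_ i (rshift 1 j)): y0.
    by rewrite row_mxEr !mxE.
  (* The vector minimizing the form of [B] serves as a competitor for [A]. *)
  move=> y; rewrite -(qc B) ?gt_eqF//; apply: le_trans (leAB _).
  by rewrite qform_schur ?gt_eqF// lerDr mulr_ge0 ?sqr_ge0// ltW.
by rewrite mulr_gt0//= ler_pM// ltW.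
Qed.

(** Along [t *: v + w] the form is affine in [t], since its quadratic coefficient is
    [qform A v = 0]. Being nonnegative for all [t], it has slope zero; for a basis vector [w] the
    slope is twice a coordinate of [v *m A]. *)
Lemma qform_ge0_kernel (F : realFieldType) (n : nat) (A : 'M[F]_n) v :
  A^T = A -> (forall w, 0 <= qform A w) -> qform A v = 0 -> v *m A = 0.
Proof.
move=> sA pA qv0; apply/rowP => j.
set w : 'rV[F]_n := delta_mx 0 j.
have wA : (v *m A *m w^T) 0 0 = (v *m A) 0 j.
  by rewrite /w trmx_delta -colE mxE.
have symvw : (w *m A *m v^T) 0 0 = (v *m A *m w^T) 0 0.
  rewrite -[in LHS](trmxK (w *m A *m v^T)) mxE 2!trmx_mul trmxK sA mulmxA.
  by [].
have qt t : qform A (t *: v + w) = t * (2 * (v *m A) 0 j) + qform A w.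
  rewrite /qform linearD linearZ /= !(mulmxDl, mulmxDr) -!scalemxAl -!scalemxAr.
  have E (M N : 'M[F]_1) : (M + N) 0 0 = M 0 0 + N 0 0 by rewrite mxE.
  have Z (M : 'M[F]_1) c : (c *: M) 0 0 = c * M 0 0 by rewrite mxE.
  by rewrite !E !Z symvw wA -/(qform A v) qv0; ring.
set b := (v *m A) 0 j in qt *; set q := qform A w in qt *.
rewrite mxE; have [//|b0] := eqVneq b 0.
(* For a nonzero slope, this parameter gives the form the value -1. *)
have := pA ((- (q + 1) / (2 * b)) *: v + w); rewrite qt.
rewrite (_ : _ / _ * _ + _ = -1) ?ler0N1//; by field.
Qed.

(** * Orthonormal frames and forms on the hyperplane orthogonal to a unit vector *)

Lemma mx11_mul (F : realFieldType) (n : nat) (u v : 'rV[F]_n) :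
  u *m v^T = ((u *m v^T) 0 0)%:M.
Proof. exact: mx11_scalar. Qed.

Lemma rV_sqr_eq0 (F : realFieldType) (n : nat) (u : 'rV[F]_n) :
  u *m u^T = 0 -> u = 0.
Proof.
move=> /matrixP/(_ 0 0); rewrite !mxE => /eqP.
rewrite psumr_eq0; last by move=> i _; rewrite mxE -expr2 sqr_ge0.
move=> /allP u0; apply/rowP => i; rewrite mxE; apply/eqP.
have := u0 i; rewrite mem_index_enum => /(_ isT).
by rewrite mxE mulf_eq0 orbb.
Qed.

(* The rows other than the first one of the Householder reflection exchanging
   [x] and the first basis vector; when these coincide, the inverse of [0] is [0]
   and the reflection degenerates to the identity, as it should. *)
Lemma frame_exists (F : realFieldType) (m : nat) (x : 'rV[F]_(1 + m)) :
  x *m x^T = 1%:M ->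
  exists E : 'M[F]_(m, 1 + m), E *m E^T = 1%:M /\ E *m x^T = 0.
Proof.
move=> x1; pose e : 'rV[F]_(1 + m) := delta_mx 0 0.
pose u := x - e; pose s := (u *m u^T) 0 0.
pose H := 1%:M - (2 / s) *: (u^T *m u).
have ee : e *m e^T = 1%:M.
  by rewrite /e trmx_delta mul_delta_mx; apply/matrixP => i j; rewrite !ord1 !mxE.
have xe : x *m e^T = e *m x^T.
  by rewrite -[RHS]trmxK trmx_mul trmxK mx11_mul tr_scalar_mx.
have sE : s = 2 * (1 - (e *m x^T) 0 0).
  rewrite /s /u linearB /= mulmxBl !mulmxBr x1 ee xe.
  by move: (e *m x^T) => a; rewrite !mxE eqxx !mulr1n; ring.
have HH : H *m H^T = 1%:M.
  have -> : H^T = H by rewrite /H linearB linearZ /= trmx_mul trmxK trmx1.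
  pose c := 2 / s; pose B := u^T *m u.
  have BB : B *m B = s *: B.
    by rewrite /B mulmxA -(mulmxA u^T u) mx11_mul mul_mx_scalar -scalemxAl.
  have cs : c * c * s = c + c.
    have [s0|s0] := eqVneq s 0; last by rewrite /c; field.
    by rewrite /c s0 invr0 !mulr0 addr0.
  rewrite /H -/c -/B mulmxBr mulmx1 mulmxBl mul1mx -scalemxAl -scalemxAr BB.
  rewrite !scalerA cs scalerDl opprB addrA.
  by rewrite addrA subrK addrK.
have eH : e *m H = x.
  rewrite /H mulmxBr mulmx1 -scalemxAr mulmxA.
  have -> : e *m u^T = (- (s / 2))%:M.
    rewrite /u linearB /= mulmxBr ee [e *m x^T]mx11_scalar -raddfB sE.
    by congr (_%:M); rewrite /=; field.
  rewrite mul_scalar_mx scalerA.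
  have [s0|s0] := eqVneq s 0.
    rewrite s0 invr0 mulr0 mul0r scale0r subr0; apply/esym/eqP.
    rewrite -subr_eq0; apply/eqP/rV_sqr_eq0; rewrite -/u mx11_mul -/s s0.
    by rewrite raddf0.
  have k (r : F) : r != 0 -> 2 / r * - (r / 2) = -1 by move=> ?; field.
  rewrite k//.
  by rewrite scaleN1r opprK /u addrC subrK.
have ux : usubmx H = x.
  rewrite -eH -rowE; apply/matrixP => i j.
  have i0 : lshift m i = 0 by rewrite ord1; apply/val_inj.
  by rewrite [LHS]mxE i0 [RHS]mxE.
exists (dsubmx H).
move: HH; rewrite -{1 2}(vsubmxK H) ux tr_col_mx mul_col_row.
by rewrite (@scalar_mx_block _ 1 m) => /eq_block_mx[_ _ -> ->].
Qed.

(* The form [K] restricted to the hyperplane orthogonal to [x], completed by the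
   identity on the line of [x]: forms on different tangent spaces of the sphere
   become matrices of the same size, depending continuously on [x]. *)
Definition tproj {F : realFieldType} {m : nat} (x : 'rV[F]_m) (K : 'M[F]_m) :=
  (1%:M - x^T *m x) *m K *m (1%:M - x^T *m x) + x^T *m x.

Section Frame.
Variables (F : realFieldType) (m : nat) (x : 'rV[F]_(1 + m)).
Variables (E : 'M[F]_(m, 1 + m)) (K : 'M[F]_(1 + m)).
Hypotheses (x1 : x *m x^T = 1%:M) (EE : E *m E^T = 1%:M).
Hypotheses (Ex : E *m x^T = 0).

(** Stacking [x] on top of [E] gives a square matrix with orthonormal rows, hence also with
    orthonormal columns. *)
Lemma frame_proj : 1%:M - x^T *m x = E^T *m E.
Proof.
have : col_mx x E *m (col_mx x E)^T = 1%:M.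
  rewrite tr_col_mx mul_col_row x1 EE Ex -[x *m E^T]trmxK trmx_mul trmxK Ex.
  by rewrite trmx0 -scalar_mx_block.
move/mulmx1C; rewrite tr_col_mx mul_row_col => <-.
by rewrite addrAC subrr add0r.
Qed.

Lemma qform_tproj v :
  qform (tproj x K) v =
  qform (E *m K *m E^T) (v *m E^T) + ((v *m x^T) 0 0) ^+ 2.
Proof.
rewrite /qform /tproj frame_proj mulmxDr mulmxDl mxE; congr (_ + _).
  by congr (_ 0 0); rewrite !trmx_mul !trmxK !mulmxA.
have -> : v *m (x^T *m x) *m v^T = (v *m x^T) *m (v *m x^T)^T.
  by rewrite trmx_mul trmxK !mulmxA.
by rewrite (mx11_mul F _ v x) tr_scalar_mx -scalar_mxM !mxE eqxx !mulr1n expr2.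
Qed.

Lemma qform_tproj_frame w :
  qform (tproj x K) (w *m E) = qform (E *m K *m E^T) w.
Proof.
by rewrite qform_tproj -!mulmxA Ex EE mulmx0 mulmx1 mxE expr0n addr0 mulmxA.
Qed.

Lemma posdef_tproj : posdef (tproj x K) <-> posdef (E *m K *m E^T).
Proof.
split=> [pT w w0|pW v v0].
  rewrite -qform_tproj_frame; apply: pT; apply: contra_neq w0 => wE.
  by rewrite -[w]mulmx1 -EE mulmxA wE mul0mx.
rewrite qform_tproj; have [vE|vE] := eqVneq (v *m E^T) 0; last first.
  by rewrite ltr_wpDr ?sqr_ge0//; exact: pW.
(* Here [v] is a multiple of [x], and only the square of its component along [x] is left. *)
rewrite vE /qform !mul0mx mxE add0r lt_neqAle sqr_ge0 andbT eq_sym sqrf_eq0.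
apply: contra_neq v0 => vx.
have : v *m (1%:M - x^T *m x) = 0 by rewrite frame_proj mulmxA vE mul0mx.
rewrite mulmxBr mulmx1 mulmxA (mx11_mul F _ v x) vx mul_scalar_mx scale0r subr0.
by [].
Qed.

(** A nonnegative form that vanishes at a nonzero vector has it in its kernel, which the nonzero
    determinant excludes. Thus positive definiteness cannot be lost in a limit. *)
Lemma possemidef_tproj : K^T = K -> (forall v, 0 <= qform (tproj x K) v) ->
  \det (E *m K *m E^T) != 0 -> posdef (tproj x K).
Proof.
move=> sK pT dW; apply/posdef_tproj => w w0.
rewrite lt_neqAle -{2}(qform_tproj_frame w) pT andbT eq_sym.
apply: contra dW => /eqP qw; apply/det0P; exists w => //.
apply: qform_ge0_kernel qw; first by rewrite !trmx_mul trmxK sK mulmxA.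
by move=> z; rewrite -qform_tproj_frame.
Qed.
End Frame.

(** * Second derivatives: mean values, symmetry, and the test at a maximum *)

Section SecondDerivatives.
Variables (R : realType) (V : normedModType R).
Implicit Types (f : V -> R) (x v w : V) (s t : R).

Lemma is_derive_line f x v s : derivable f (s *: v + x) v ->
  is_derive s 1 (fun t => f (t *: v + x)) ('D_v f (s *: v + x)).
Proof.
move=> df.
have E : (fun h : R => h^-1 *: (((fun t => f (t *: v + x)) \o shift s) (h *: 1) -
              (fun t => f (t *: v + x)) s)) =
         (fun h : R => h^-1 *: ((f \o shift (s *: v + x)) (h *: v) - f (s *: v + x))).
  by apply/funext => h /=; rewrite [h *: 1]mulr1 scalerDl addrA.
by apply: DeriveDef; rewrite /derivable /derive E.
Qed.

Lemma MVT_line f x v t : 0 < t ->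
  (forall s, 0 <= s <= t -> derivable f (s *: v + x) v) ->
  exists2 s, 0 < s < t & f (t *: v + x) - f x = t * 'D_v f (s *: v + x).
Proof.
move=> t0 df.
have [||s st] := @MVT R (fun s => f (s *: v + x))
  (fun s => 'D_v f (s *: v + x)) 0 t t0.
- move=> s; rewrite in_itv/= => /andP[s0 st]; apply/is_derive_line/df.
  by rewrite !ltW.
- apply: derivable_within_continuous => s; rewrite in_itv/= => st.
  by have [] := is_derive_line f x v s (df s st).
rewrite scale0r add0r subr0 => E; exists s; last by rewrite E mulrC.
by move: st; rewrite in_itv.
Qed.

(** Two mean value theorems: along [v] for the increment of [f] by [t *: w], then along [w] for
    ['D_v f]. *)
Lemma second_difference f x v w t : 0 < t ->
  (forall s r : R, 0 <= s <= t -> 0 <= r <= t ->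
     derivable f (r *: w + (s *: v + x)) v /\
     derivable ('D_v f) (r *: w + (s *: v + x)) w) ->
  exists s r : R, [/\ 0 < s < t, 0 < r < t &
    f (t *: w + (t *: v + x)) - f (t *: v + x) - (f (t *: w + x) - f x) =
    t * (t * 'D_w ('D_v f) (r *: w + (s *: v + x)))].
Proof.
move=> t0 df.
have t0t : 0 <= t <= t by rewrite ltW ?lexx.
have z0t : (0 : R) <= 0 <= t by rewrite lexx ltW.
pose g s := f (s *: v + (t *: w + x)) - f (s *: v + x).
have dg s : 0 <= s <= t -> is_derive s 1 g
    ('D_v f (s *: v + (t *: w + x)) - 'D_v f (s *: v + x)).
  move=> st; apply: is_deriveB; apply: is_derive_line.
    by rewrite addrCA; exact: (proj1 (df s t st t0t)).
  by have [] := df s 0 st z0t; rewrite scale0r add0r.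
have [||s st] := @MVT R g
  (fun s => 'D_v f (s *: v + (t *: w + x)) - 'D_v f (s *: v + x)) 0 t t0.
- by move=> s; rewrite in_itv/= => /andP[s0 st]; apply: dg; rewrite !ltW.
- apply: derivable_within_continuous => s; rewrite in_itv/= => st.
  by have [] := dg s st.
rewrite in_itv/= in st; have /andP[s0 s1] := st.
have st' : 0 <= s <= t by rewrite !ltW.
have [r rt Er] := MVT_line ('D_v f) (s *: v + x) w t t0
  (fun r rt => proj2 (df s r st' rt)).
rewrite addrCA Er subr0 /g scale0r !add0r addrCA => E.
by exists s, r; split => //; rewrite E mulrC.
Qed.

(** The second difference is symmetric in [v] and [w], so the two mixed derivatives agree at two
    points arbitrarily close to [x]; continuity at [x] does the rest. *)
Lemma derive_comm f x v w :
  (\forall y \near x, [/\ derivable f y v, derivable f y w,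
     derivable ('D_v f) y w & derivable ('D_w f) y v]) ->
  {for x, continuous ('D_w ('D_v f))} -> {for x, continuous ('D_v ('D_w f))} ->
  'D_w ('D_v f) x = 'D_v ('D_w f) x.
Proof.
move=> df cvw cwv; apply/eqP; rewrite -subr_eq0 -normr_le0.
apply/ler_addgt0Pl => e e0; rewrite addr0.
have e20 : 0 < e / 2 by rewrite divr_gt0.
have := cvw; move/cvgrPdist_lt => /(_ _ e20) cvw'.
have := cwv; move/cvgrPdist_lt => /(_ _ e20) cwv'.
have [d /= d0 Hd] := proj1 (nbhs_ballP _ _) (filterI df (filterI cvw' cwv')).
(* With this [t] the whole parallelogram spanned by [t *: v] and [t *: w] at [x] lies in the ball of
   radius [d]; the summand 1 covers [v = w = 0]. *)
pose N := `|v| + `|w| + 1; pose t := d / N.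
have N0 : 0 < N by rewrite ltr_wpDl // addr_ge0.
have t0 : 0 < t by rewrite divr_gt0.
have inb s r : 0 <= s <= t -> 0 <= r <= t -> ball x d (r *: w + (s *: v + x)).
  move=> /andP[s0 st] /andP[r0 rt]; rewrite -ball_normE /ball_ /=.
  rewrite addrA opprD addrCA subrr addr0 normrN.
  rewrite (le_lt_trans (ler_normD _ _))// !normrZ !ger0_norm//.
  rewrite (@le_lt_trans _ _ (t * (`|w| + `|v|)))//.
    by rewrite mulrDr lerD// ler_wpM2r.
  by rewrite /t mulrAC ltr_pdivrMr// ltr_pM2l// /N addrC ltrDl.
have [|s [r [st rt E1]]] := second_difference f x v w t t0.
  move=> s r st rt; have [[dv _ dvw _] _] := Hd _ (inb s r st rt).
  exact: conj dv dvw.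
have [|s' [r' [st' rt' E2]]] := second_difference f x w v t t0.
  move=> a b sa sb; rewrite addrCA.
  have [[_ dw _ dwv] _] := Hd _ (inb _ _ sb sa); exact: conj dw dwv.
have : t * (t * 'D_w ('D_v f) (r *: w + (s *: v + x))) =
       t * (t * 'D_v ('D_w f) (r' *: v + (s' *: w + x))).
  apply: (etrans (esym E1)); apply: (etrans _ E2); rewrite addrCA.
  have sub4 (c1 c2 c3 c4 : R) : c1 - c2 - (c3 - c4) = c1 - c3 - (c2 - c4) by ring.
  exact: sub4.
move/(mulfI (lt0r_neq0 t0))/(mulfI (lt0r_neq0 t0)) => E.
have lt2 u : 0 < u < t -> 0 <= u <= t by move=> /andP[? ?]; rewrite !ltW.
have y1 := inb s r (lt2 _ st) (lt2 _ rt).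
have y2 := inb r' s' (lt2 _ rt') (lt2 _ st').
rewrite addrCA in y2.
move: (r *: w + _) (r' *: v + _) y1 y2 E => y1 y2 /Hd[_ [/= b1 _]] /Hd[_ [_ /= b2]] E.
rewrite E in b1; rewrite distrC in b2.
move: ('D_w ('D_v f) x) ('D_v ('D_w f) y2) ('D_v ('D_w f) x) b1 b2 => A B C b1 b2.
clear -b1 b2; rewrite ltW// (splitr e) (le_lt_trans _ (ltrD b1 b2))//.
by rewrite -[A - C](subrKA B) ler_normD.
Qed.

(** The first derivative vanishes as in one variable. Were the second one positive, ['D_v f] would
    be positive just after [x] along [v], and the mean value theorem would give a value above
    [f x]. *)
Lemma derive_at_max f x v : (\forall y \near x, derivable f y v) ->
  (\forall y \near x, f y <= f x) -> derivable ('D_v f) x v ->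
  'D_v f x = 0 /\ 'D_v ('D_v f) x <= 0.
Proof.
move=> df fx ddf.
have [d /= d0 Hd] := proj1 (nbhs_ballP _ _) (filterI df fx).
pose e := d / (`|v| + 1).
have v0 : 0 < `|v| + 1 by rewrite ltr_wpDl.
have e0 : 0 < e by rewrite divr_gt0.
have inb s : `|s| < e -> ball x d (s *: v + x).
  move=> se; rewrite -ball_normE /ball_ /= opprD addrCA subrr addr0 normrN normrZ.
  rewrite (@le_lt_trans _ _ (`|s| * (`|v| + 1))) ?ler_wpM2l ?lerDl//.
  by rewrite -ltr_pdivlMr.
have D0 : 'D_v f x = 0.
  have df0 : derivable f (0 *: v + x) v.
    by have [] := Hd _ (inb 0 _); rewrite ?normr0.
  have [_] := is_derive_line f x v 0 df0; rewrite scale0r add0r => <-.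
  have [||||//] := @derive1_at_max R (fun s => f (s *: v + x)) (- e) e 0.
  - by rewrite (@le_trans _ _ 0) ?oppr_le0 ?(ltW e0).
  - move=> s; rewrite in_itv/= -ltr_norml => /inb/Hd[ds _].
    by have [] := is_derive_line f x v s ds.
  - by rewrite in_itv/= oppr_lt0 e0.
  - move=> s; rewrite in_itv/= -ltr_norml => /inb/Hd[_ fs].
    by rewrite scale0r add0r.
split => //; rewrite leNgt; apply/negP => L0.
move: ddf => /cvg_ex[l lE].
have lE' : 'D_v ('D_v f) x = l by apply: cvg_lim lE.
rewrite lE' in L0.
move/cvgr_gt: lE => /(_ _ L0) [c /= c0 Hc].
pose b := Num.min c e / 2.
have b0 : 0 < b by rewrite divr_gt0 // lt_min c0.
have bm : b < Num.min c e by rewrite /b ltr_pdivrMr// ltr_pMr ?ltr1n// lt_min c0.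
have [bc be] : b < c /\ b < e by move: bm; rewrite lt_min => /andP[].
have [s sb|s /andP[s0 sb] E] := MVT_line f x v b b0.
  apply: (proj1 (Hd _ (inb s _))).
  by case/andP: sb => ? sb; rewrite ger0_norm// (le_lt_trans sb).
(* By [D0] the difference quotient of ['D_v f] at [x] reduces to [s^-1 *: 'D_v f (s *: v + x)],
   which is positive for such [s]. *)
have := Hc s; rewrite /ball_ /= sub0r normrN gtr0_norm// D0 subr0.
move=> /(_ (lt_trans sb bc)) /(_ (lt0r_neq0 s0)).
rewrite [_ *: _]mulrC pmulr_lgt0 ?invr_gt0// => Dp.
have bE : `|b| < e by rewrite gtr0_norm.
have [_] := Hd _ (inb b bE).
by rewrite leNgt -subr_gt0 E mulr_gt0.
Qed.

End SecondDerivatives.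

(** * The Euclidean norm and the compact sphere *)

Definition normalize {R : realType} {n : nat} (y : 'rV[R]_n) : 'rV[R]_n :=
  (enorm y)^-1 *: y.

Section Sphere.
Variables (R : realType) (n : nat).
Implicit Types (x u v w : 'rV[R]_n) (h : 'rV[R]_n -> R).

Lemma dotvE u v : dotv u v = (u *m v^T) 0 0.
Proof. by rewrite mxE; apply: eq_bigr => i _; rewrite mxE. Qed.

Lemma dotv_ge0 u : 0 <= dotv u u.
Proof. by apply: sumr_ge0 => i _; rewrite -expr2 sqr_ge0. Qed.

Lemma dotv_gt0 u : u != 0 -> 0 < dotv u u.
Proof.
move=> u0; rewrite lt_neqAle dotv_ge0 andbT eq_sym; apply: contra_neq u0.
rewrite dotvE => u0; apply: rV_sqr_eq0.
by rewrite mx11_mul u0 raddf0.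
Qed.

Lemma enorm_gt0 u : u != 0 -> 0 < enorm u.
Proof. by move=> u0; rewrite sqrtr_gt0 dotv_gt0. Qed.

Lemma enormZ (c : R) u : enorm (c *: u) = `|c| * enorm u.
Proof.
rewrite /enorm -sqrtr_sqr -sqrtrM ?sqr_ge0//; congr Num.sqrt.
by rewrite /dotv mulr_sumr; apply: eq_bigr => i _; rewrite !mxE; ring.
Qed.

Lemma sphere_mulmx x : sphere x -> x *m x^T = 1%:M.
Proof.
rewrite /sphere /= => x1; rewrite mx11_mul -dotvE; congr (_%:M).
by rewrite -(sqr_sqrtr (dotv_ge0 x)) -/(enorm x) x1 expr1n.
Qed.

Lemma sphere_neq0 x : sphere x -> x != 0.
Proof.
move=> x1; apply/eqP => x0; move: x1; rewrite /sphere /= x0 -(scale0r 0) enormZ.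
by rewrite normr0 mul0r => /esym/eqP; rewrite oner_eq0.
Qed.

Lemma sphere_normalize x : x != 0 -> sphere (normalize x).
Proof.
move=> /enorm_gt0 x0; rewrite /sphere /normalize /= enormZ.
rewrite ger0_norm ?invr_ge0 ?(ltW x0)//.
by rewrite mulVf ?gt_eqF.
Qed.

Lemma hom0_sphere h x : sphere x -> hom0 h x = h x.
Proof. by rewrite /sphere /hom0 /= => ->; rewrite invr1 scale1r. Qed.

Lemma near_neq0 x : x != 0 -> \forall y \near x, y != 0.
Proof. by move=> x0; near=> y; near: y; apply: (cvgr_neq0 x).
Unshelve. all: by end_near. Qed.

(** The ambient norm on row vectors is the sup norm; this bound makes the Euclidean sphere bounded
    for it. *)
Lemma norm_le_enorm x : `|x| <= enorm x.
Proof.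
suff: mx_norm x <= enorm x by [].
have [->|/mx_norm_neq0[[i j] /= ->]] := eqVneq (mx_norm x) 0; first exact: sqrtr_ge0.
rewrite ord1 -sqrtr_sqr ler_sqrt ?dotv_ge0// /dotv (bigD1 j)//= -expr2 lerDl.
by apply: sumr_ge0 => k _; rewrite -expr2 sqr_ge0.
Qed.

Lemma differentiable_dotv x : differentiable (fun y => dotv y y) x.
Proof.
rewrite (_ : (fun y => _) =
  \sum_(i < n) (fun y : 'rV[R]_n => y 0 i * y 0 i)); last first.
  by apply/funext => y; rewrite fct_sumE.
apply: differentiable_sum => i; apply: differentiableM; exact: differentiable_coord.
Qed.

Lemma differentiable_enorm x : x != 0 -> differentiable (@enorm R n) x.
Proof.
move=> x0; apply: (@differentiable_comp _ _ _ _ (fun y => dotv y y) Num.sqrt).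
  exact: differentiable_dotv.
apply/derivable1_diffP.
by have [] := is_derive1_sqrt (dotv_gt0 x x0).
Qed.

Lemma continuous_enorm : continuous (@enorm R n).
Proof.
move=> x; apply: (@continuous_comp _ _ _ (fun y => dotv y y) Num.sqrt).
  exact: differentiable_continuous (differentiable_dotv x).
exact: sqrt_continuous.
Qed.
Lemma sphere_compact : compact (@sphere R n).
Proof.
apply: bounded_closed_compact.
  exists 1; split; first exact: num_real.
  move=> M M1 x xs /=; rewrite (le_trans _ (ltW M1))// (le_trans (norm_le_enorm x))//.
  by rewrite (xs : _ = _).
have -> : @sphere R n = (@enorm R n) @^-1` [set 1] by [].
apply: closed_comp; last exact: closed_eq.
by move=> x _; exact: continuous_enorm.
Qed.
End Sphere.

(** * Hessians of homogeneous extensions and functions that touch *)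

Definition ambient_hess {R : realType} {n : nat} (h : 'rV[R]_n -> R) x : 'M[R]_n :=
  \matrix_(i, j) 'D_(delta_mx 0 j) ('D_(delta_mx 0 i) (hom0 h)) x.

Section Hessian.
Variables (R : realType) (n : nat).
Implicit Types (x y u v w : 'rV[R]_n) (h : 'rV[R]_n -> R).

Lemma derive_rV (f : 'rV[R]_n -> R) x v : differentiable f x ->
  'D_v f x = \sum_(i < n) v 0 i * 'D_(delta_mx 0 i) f x.
Proof.
move=> df; rewrite deriveE// [in LHS](row_sum_delta v) linear_sum.
by apply: eq_bigr => i _; rewrite linearZ deriveE.
Qed.

Lemma C2_derivable h x v : C2_sphere h -> x != 0 -> derivable (hom0 h) x v.
Proof. by move=> hC /hC[df _]; apply: diff_derivable. Qed.

Lemma C2_derivable2 h x v w : C2_sphere h -> x != 0 ->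
  derivable ('D_v (hom0 h)) x w.
Proof. by move=> hC /hC[_ /(_ v)[df _]]; apply: diff_derivable. Qed.

Lemma cov_hessE h x v w : C2_sphere h -> x != 0 ->
  cov_hess h x v w = (v *m ambient_hess h x *m w^T) 0 0.
Proof.
move=> hC x0; rewrite /cov_hess.
(* Linearity in [v] is needed on a neighbourhood of [x], because it is then differentiated along
   [w]. *)
have E : \near x, 'D_v (hom0 h) x =
    (\sum_(i < n) v 0 i *: 'D_(delta_mx 0 i) (hom0 h)) x.
  apply: filterS (near_neq0 _ _ x x0) => y y0.
  by rewrite fct_sumE derive_rV//; have [] := hC y y0.
rewrite (near_eq_derive _ E) derive_sum; last first.
  by move=> i; apply: derivableZ; exact: C2_derivable2.
transitivity (\sum_(i < n) \sum_(j < n)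
    v 0 i * (w 0 j * ambient_hess h x i j)).
  apply: eq_bigr => i _; rewrite deriveZ; last exact: C2_derivable2.
  rewrite derive_rV; last by have [_ /(_ (delta_mx 0 i))[]] := hC x x0.
  by rewrite scaler_sumr; apply: eq_bigr => j _; rewrite mxE.
rewrite exchange_big /= mxE; apply: eq_bigr => j _.
by rewrite !mxE mulr_suml; apply: eq_bigr => i _; ring.
Qed.

Lemma ambient_hess_sym h x : C2_sphere h -> x != 0 ->
  (ambient_hess h x)^T = ambient_hess h x.
Proof.
move=> hC x0; apply/matrixP => i j; rewrite !mxE.
apply: derive_comm.
- apply: filterS (near_neq0 _ _ x x0) => y y0; split.
  + exact: C2_derivable.
  + exact: C2_derivable.
  + exact: C2_derivable2.
  + exact: C2_derivable2.
- by have [_ /(_ (delta_mx 0 j))[_ /(_ (delta_mx 0 i))]] := hC x x0.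
- by have [_ /(_ (delta_mx 0 i))[_ /(_ (delta_mx 0 j))]] := hC x x0.
Qed.

Lemma hess_mxE h x (E : 'M[R]_(n.-1, n)) : C2_sphere h -> x != 0 ->
  E *m E^T = 1%:M ->
  hess_mx h x E = E *m (ambient_hess h x + (h x)%:M) *m E^T.
Proof.
move=> hC x0 EE; rewrite mulmxDr mulmxDl mul_mx_scalar -scalemxAl EE.
apply/matrixP => i j; rewrite mxE [RHS]mxE; congr (_ + _); last by rewrite !mxE.
rewrite cov_hessE// -row_mul mxE [RHS]mxE; apply: eq_bigr => k _.
by rewrite !mxE.
Qed.

(** Lets [hess_touch] compare a function with its minimum value. *)
Lemma C2_cst (c : R) : C2_sphere (fun _ : 'rV[R]_n => c).
Proof.
move=> x x0; rewrite /hom0.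
have D0 (a : R) v : 'D_v (fun _ : 'rV[R]_n => a) = cst 0.
  by apply/funext => y; exact: derive_cst.
split; first exact: differentiable_cst.
move=> v; rewrite D0; split; first exact: differentiable_cst.
by move=> w; rewrite D0; exact: cst_continuous.
Qed.

(** Homogeneity of degree 0 turns contact on the sphere into a local maximum of [G] in the full
    space, where [derive_at_max] applies along every [v]. *)
Lemma hess_touch h1 h2 t x : C2_sphere h1 -> C2_sphere h2 -> x != 0 ->
  (forall y, y != 0 -> hom0 h1 y <= t * hom0 h2 y) ->
  hom0 h1 x = t * hom0 h2 x -> forall v,
  'D_v (hom0 h1) x = t * 'D_v (hom0 h2) x /\
  cov_hess h1 x v v <= t * cov_hess h2 x v v.
Proof.
move=> C1 C2 x0 le12 eq12 v; rewrite /cov_hess.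
pose G := hom0 h1 - t *: hom0 h2.
have dG y u : y != 0 -> derivable G y u.
  by move=> y0; apply: derivableB; [|apply: derivableZ]; exact: C2_derivable.
have DG y : y != 0 -> 'D_v G y = ('D_v (hom0 h1) - t *: 'D_v (hom0 h2)) y.
  move=> y0; rewrite deriveB; [|exact: C2_derivable|].
    by rewrite deriveZ//; exact: C2_derivable.
  by apply: derivableZ; exact: C2_derivable.
have nDG : \near x, ('D_v (hom0 h1) - t *: 'D_v (hom0 h2)) x = 'D_v G x.
  by apply: filterS (near_neq0 _ _ x x0) => y y0; rewrite DG.
have d2 : derivable ('D_v (hom0 h1) - t *: 'D_v (hom0 h2)) x v.
  by apply: derivableB; [|apply: derivableZ]; exact: C2_derivable2.
have [] := derive_at_max _ _ G x v.
- by apply: filterS (near_neq0 _ _ x x0) => y y0; exact: dG.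
- apply: filterS (near_neq0 _ _ x x0) => y y0.
  rewrite -[G x]/(hom0 h1 x - t * hom0 h2 x) eq12 subrr.
  by rewrite -[G y]/(hom0 h1 y - t * hom0 h2 y) subr_le0 le12.
- exact: near_eq_derivable nDG d2.
rewrite DG// -(near_eq_derive _ nDG) deriveB; last 2 first.
- exact: C2_derivable2.
- by apply: derivableZ; exact: C2_derivable2.
rewrite deriveZ; last exact: C2_derivable2.
move=> /eqP; rewrite subr_eq0 => /eqP D1; rewrite subr_le0 => D2.
exact: conj D1 D2.
Qed.

Lemma differentiable_hom1 h x : C2_sphere h -> x != 0 ->
  differentiable (hom1 h) x.
Proof.
move=> hC x0; rewrite (_ : hom1 h = @enorm R n * hom0 h)//.
by apply: differentiableM; [exact: differentiable_enorm | have [] := hC x x0].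
Qed.

(** By the product rule for [enorm] times [hom0], the gradient depends only on the value and first
    derivatives of [hom0], all of which scale by [t] at the contact point. *)
Lemma Dh_touch h1 h2 t x : C2_sphere h1 -> C2_sphere h2 -> x != 0 ->
  (forall y, y != 0 -> hom0 h1 y <= t * hom0 h2 y) ->
  hom0 h1 x = t * hom0 h2 x -> Dh h1 x = t *: Dh h2 x.
Proof.
move=> C1 C2 x0 le12 eq12; apply/rowP => k; rewrite !mxE.
have dE v : derivable (@enorm R n) x v.
  by apply: diff_derivable; exact: differentiable_enorm.
have D h v : C2_sphere h -> 'D_v (hom1 h) x =
    enorm x * 'D_v (hom0 h) x + hom0 h x * 'D_v (@enorm R n) x.
  move=> hC; rewrite (_ : hom1 h = @enorm R n * hom0 h)//.
  by rewrite deriveM//; exact: C2_derivable.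
rewrite !D// eq12.
by have [-> _] := hess_touch h1 h2 t x C1 C2 x0 le12 eq12 (delta_mx 0 k); ring.
Qed.

Lemma hom1Z h (s : R) x : 0 < s -> hom1 h (s *: x) = s * hom1 h x.
Proof.
move=> s0; rewrite /hom1 enormZ gtr0_norm// mulrA; congr (_ * h _).
by rewrite scalerA invfM mulrAC mulVf ?gt_eqF// mul1r.
Qed.

(** Euler's identity: differentiate [hom1 h (s *: x) = s * hom1 h x] at [s = 1]. *)
Lemma Dh_euler h x : C2_sphere h -> x != 0 -> dotv x (Dh h x) = hom1 h x.
Proof.
move=> hC x0; have dh := differentiable_hom1 h x hC x0.
rewrite /dotv; under eq_bigr do rewrite mxE.
rewrite -derive_rV//.
have := is_derive_line R _ (hom1 h) 0 x 1; rewrite scale1r addr0.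
move=> /(_ (diff_derivable dh))[_ <-].
transitivity ('D_1 (fun s : R => s * hom1 h x) 1).
  apply: near_eq_derive; near=> s; rewrite addr0 hom1Z//.
  by near: s; apply: lt_nbhsr.
by rewrite deriveMr// derive_id mulr1.
Unshelve. all: by end_near. Qed.

(** By Euler's identity the component of [Dh h x] along [x] is [h x]. This provides the positive
    radius required by [gprof_decreasing]. *)
Lemma Dh_neq0 h x : C2_sphere h -> sphere x -> 0 < h x -> Dh h x != 0.
Proof.
move=> hC xs hx; have x0 := sphere_neq0 _ _ _ xs.
apply: contraTneq hx => D0; have := Dh_euler h x hC x0.
rewrite D0 dotvE trmx0 mulmx0 mxE /hom1 (xs : enorm x = 1).
by rewrite invr1 scale1r mul1r => <-; rewrite ltxx.
Qed.

End Hessian.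

(** * Continuous families of matrices and openness of positive definiteness *)

Section EntrywiseContinuity.
Variables (R : realType) (T : topologicalType).

(** Entrywise, so that matrix operations reduce to finite sums and products of real functions. *)
Definition mx_continuous_at (p r : nat) (M : T -> 'M[R]_(p, r)) (x : T) : Prop :=
  forall i j, {for x, continuous (fun z => M z i j)}.

Lemma continuous_at_ext (f g : T -> R) x : f =1 g ->
  {for x, continuous g} -> {for x, continuous f}.
Proof. by move=> /funext ->. Qed.

Lemma continuous_at_sum (I : finType) (F : I -> T -> R) x :
  (forall i, {for x, continuous (F i)}) ->
  {for x, continuous (fun z => \sum_i F i z)}.
Proof.
move=> Fc; apply: cvg_big => [|i _]; last exact: Fc.
exact: add_continuous.
Qed.

Lemma mx_continuous_mul p r s (M : T -> 'M[R]_(p, r)) (N : T -> 'M[R]_(r, s)) x :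
  mx_continuous_at p r M x -> mx_continuous_at r s N x ->
  mx_continuous_at p s (fun z => M z *m N z) x.
Proof.
move=> Mc Nc i j; apply: (continuous_at_ext _ (fun z => \sum_k M z i k * N z k j)).
  by move=> z; rewrite mxE.
by apply: continuous_at_sum => k; apply: continuousM; [exact: Mc|exact: Nc].
Qed.

Lemma mx_continuous_add p r (M N : T -> 'M[R]_(p, r)) x :
  mx_continuous_at p r M x -> mx_continuous_at p r N x ->
  mx_continuous_at p r (fun z => M z + N z) x.
Proof.
move=> Mc Nc i j; apply: (continuous_at_ext _ (fun z => M z i j + N z i j)).
  by move=> z; rewrite mxE.
by apply: continuousD; [exact: Mc|exact: Nc].
Qed.

Lemma mx_continuous_cst p r (M : 'M[R]_(p, r)) x :
  mx_continuous_at p r (fun=> M) x.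
Proof. by move=> i j; exact: cst_continuous. Qed.

Lemma mx_continuous_opp p r (M : T -> 'M[R]_(p, r)) x :
  mx_continuous_at p r M x -> mx_continuous_at p r (fun z => - M z) x.
Proof.
move=> Mc i j; apply: (continuous_at_ext _ (fun z => - M z i j)).
  by move=> z; rewrite mxE.
by apply: continuousN; exact: Mc.
Qed.

Lemma mx_continuous_tr p r (M : T -> 'M[R]_(p, r)) x :
  mx_continuous_at p r M x -> mx_continuous_at r p (fun z => (M z)^T) x.
Proof.
move=> Mc i j; apply: (continuous_at_ext _ (fun z => M z j i)) => [z|].
  by rewrite mxE.
exact: Mc.
Qed.

Lemma mx_continuous_scalar p (f : T -> R) x :
  {for x, continuous f} -> mx_continuous_at p p (fun z => (f z)%:M) x.
Proof.
move=> fc i j; apply: (continuous_at_ext _ (fun z => f z *+ (i == j))) => [z|].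
  by rewrite mxE.
by case: (i == j) => //=; exact: cst_continuous.
Qed.

Lemma mx_continuous_qform p (M : T -> 'M[R]_p) v x :
  mx_continuous_at p p M x -> {for x, continuous (fun z => qform (M z) v)}.
Proof.
move=> Mc; apply: (mx_continuous_mul _ _ _ (fun z => v *m M z) (fun=> v^T)).
  by apply: mx_continuous_mul => //; exact: mx_continuous_cst.
exact: mx_continuous_cst.
Qed.

End EntrywiseContinuity.

Lemma qform_continuous (R : realType) p (A : 'M[R]_p) :
  continuous (fun v : 'rV[R]_p => qform A v).
Proof.
move=> v.
apply: (@mx_continuous_mul R 'rV[R]_p 1 p 1 (fun w => w *m A) (fun w => w^T)).
  apply: mx_continuous_mul; last exact: mx_continuous_cst.
  by move=> i j; exact: coord_continuous.
by apply: mx_continuous_tr => i j; exact: coord_continuous.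
Qed.

(** On the compact unit sphere [K] of the sup norm the form of [M x] has a positive minimum, and
    there the form of [M z] differs from it by at most the sum [g z] of the entrywise distances.
    Homogeneity extends positivity to all nonzero vectors. *)
Lemma posdef_near (R : realType) (T : topologicalType) p (M : T -> 'M[R]_p) x :
  mx_continuous_at R T p p M x -> posdef (M x) -> \forall z \near x, posdef (M z).
Proof.
move=> Mc pM.
pose K := [set v : 'rV[R]_p | `|v| = 1].
have qZ (A : 'M[R]_p) (c : R) v : qform A (c *: v) = c ^+ 2 * qform A v.
  by rewrite /qform linearZ -!scalemxAl -scalemxAr scalerA mxE expr2.
have toK v : v != 0 -> K (`|v|^-1 *: v).
  by move=> v0; rewrite /K /= normrZ normfV normr_id mulVf// normr_eq0.
(* Without unit vectors (size 0) there is nothing to check. *)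
have [K0|K0] := pselect (K !=set0); last first.
  by near=> z; move=> v /toK vK; case: K0; exists (`|v|^-1 *: v).
have cK : compact K.
  apply: bounded_closed_compact.
    exists 1; split; first exact: num_real.
    by move=> b b1 v /= ->; exact: ltW.
  have -> : K = (fun v : 'rV[R]_p => `|v|) @^-1` [set 1] by [].
  apply: closed_comp; last exact: closed_eq.
  by move=> v _; exact: norm_continuous.
have qE (A : 'M[R]_p) (v : 'rV[R]_p) :
    qform A v = \sum_i \sum_j A i j * (v 0 i * v 0 j).
  rewrite /qform mxE exchange_big /=; apply: eq_bigr => j _.
  by rewrite !mxE mulr_suml; apply: eq_bigr => i _; ring.
have qc := qform_continuous R p (M x).
have [v0 v0K minv0] := @EVT_min_rV R p _ K K0 cK (continuous_subspaceT qc).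
rewrite inE /K /= in v0K.
have c0 : 0 < qform (M x) v0.
  by apply: pM; rewrite -normr_eq0 v0K oner_eq0.
pose g z := \sum_i \sum_j `|M x i j - M z i j|.
have g0 : g x = 0.
  by rewrite /g big1// => i _; rewrite big1// => j _; rewrite subrr normr0.
have gc : {for x, continuous g}.
  apply: continuous_at_sum => i; apply: continuous_at_sum => j.
  apply: (@continuous_comp _ _ _ (fun z => M x i j - M z i j) Num.norm).
    by apply: continuousB; [exact: cst_continuous|exact: Mc].
  exact: norm_continuous.
have : \forall z \near x, g z < qform (M x) v0.
  by apply: (cvgr_lt (g x) gc); rewrite g0.
apply: filterS => z gz v vn0.
have -> : v = `|v| *: (`|v|^-1 *: v).
  by rewrite scalerA mulfV ?scale1r// normr_eq0.
rewrite qZ mulr_gt0 ?exprn_gt0 ?normr_gt0//.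
have := toK v vn0; move: (`|v|^-1 *: v) => w wK.
have coordK i : `|w 0 i| <= 1.
  rewrite -(wK : `|w| = 1); suff: `|w 0 i| <= mx_norm w by [].
  by rewrite mx_normrE (le_bigmax _ _ (0, i)).
have : qform (M x) w - qform (M z) w <= g z.
  rewrite !qE -sumrB ler_sum// => i _; rewrite -sumrB ler_sum// => j _.
  rewrite -mulrBl (le_trans (ler_norm _))// normrM ler_piMr// normrM.
  by rewrite mulr_ile1.
move=> qg; have := minv0 w (mem_set wK) => qw.
lra.
Unshelve. all: by end_near. Qed.

(** * Propagation of positive definiteness over the sphere *)

Definition curv_mx {R : realType} {n : nat} (h : 'rV[R]_n -> R) (x : 'rV[R]_n) :=
  tproj x (ambient_hess h x + (h x)%:M).

Section Propagation.
Variables (R : realType) (m : nat) (h : 'rV[R]_m.+1 -> R).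
Hypothesis hC : C2_sphere h.

Lemma continuous_normalize (x : 'rV[R]_m.+1) : x != 0 ->
  {for x, continuous (@normalize R m.+1)}.
Proof.
move=> x0; apply: continuousZ; last exact: id.
apply: continuousV; first by rewrite gt_eqF// enorm_gt0.
exact: continuous_enorm.
Qed.

Lemma curv_mx_continuous x : x != 0 ->
  mx_continuous_at R _ _ _ (fun y => curv_mx h (normalize y)) x.
Proof.
move=> x0; have nx0 := sphere_neq0 _ _ _ (sphere_normalize _ _ x x0).
have nc : mx_continuous_at R _ _ _ (@normalize R m.+1) x.
  move=> i j; apply: (@continuous_comp _ _ _ (@normalize R m.+1)
    (fun y : 'rV[R]_m.+1 => y i j)).
    exact: continuous_normalize.
  exact: coord_continuous.
have nn : mx_continuous_at R _ _ _ (fun y => (normalize y)^T *m normalize y) x.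
  by apply: mx_continuous_mul => //; exact: mx_continuous_tr.
have pn : mx_continuous_at R _ _ _
    (fun y => 1%:M - (normalize y)^T *m normalize y) x.
  by apply: mx_continuous_add; [exact: mx_continuous_cst|exact: mx_continuous_opp].
apply: mx_continuous_add => //.
apply: mx_continuous_mul => //.
apply: mx_continuous_mul => //.
apply: mx_continuous_add.
  move=> i j; apply: (continuous_at_ext _ _ _
    ('D_(delta_mx 0 j) ('D_(delta_mx 0 i) (hom0 h)) \o normalize)).
    by move=> y; rewrite mxE.
  apply: continuous_comp; first exact: continuous_normalize.
  by have [_ /(_ (delta_mx 0 i))[_]] := hC _ nx0; exact.
(* By definition [h (normalize y)] is [hom0 h y]. *)
apply: mx_continuous_scalar.
have [d _] := hC _ x0; exact: differentiable_continuous d.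
Qed.

Hypothesis hdet : forall x E, sphere x -> tangent_frame x E ->
  \det (hess_mx h x E) != 0.

Lemma sphere_frame (x : 'rV[R]_m.+1) :
  sphere x -> exists E, tangent_frame x E.
Proof.
move=> xs; have [E EE] := frame_exists _ m x (sphere_mulmx _ _ x xs).
by exists E.
Qed.

Lemma ambient_sym (x : 'rV[R]_m.+1) : sphere x ->
  (ambient_hess h x + (h x)%:M)^T = ambient_hess h x + (h x)%:M.
Proof.
move=> xs; rewrite linearD /= tr_scalar_mx ambient_hess_sym//.
exact: sphere_neq0 xs.
Qed.

Lemma posdef_curv_mx (x : 'rV[R]_m.+1) E : sphere x -> tangent_frame x E ->
  posdef (curv_mx h x) <-> posdef (hess_mx h x E).
Proof.
move=> xs [EE Ex]; rewrite hess_mxE//; last exact: sphere_neq0 xs.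
exact: (posdef_tproj _ m x E _ (sphere_mulmx _ _ x xs) EE Ex).
Qed.

(** Since the determinant does not vanish, failure of positive definiteness is witnessed by a
    strictly negative value, which makes it an open condition. *)
Lemma not_posdef_curv_mx x : sphere x -> ~ posdef (curv_mx h x) ->
  exists v, qform (curv_mx h x) v < 0.
Proof.
move=> xs npd; apply/not_existsP => ge0; apply: npd.
have [E fE] := sphere_frame x xs; have [EE Ex] := fE.
apply: (possemidef_tproj _ m x E _ (sphere_mulmx _ _ x xs) EE Ex).
- exact: ambient_sym.
- by move=> v; rewrite leNgt; apply/negP; exact: ge0.
- by have := hdet _ _ xs fE; rewrite hess_mxE//; exact: sphere_neq0 xs.
Qed.

(** The segment is projected radially to the sphere. Positive definiteness and its negation are both
    open in the parameter, and [[0, 1]] is connected. The whole line avoids 0, so that [M] is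
    continuous on all of [R]. *)
Lemma posdef_segment (a b : 'rV[R]_m.+1) :
  (forall s : R, s *: (b - a) + a != 0) ->
  posdef (curv_mx h (normalize a)) -> posdef (curv_mx h (normalize b)).
Proof.
move=> seg pa; pose g (s : R) : 'rV[R]_m.+1 := s *: (b - a) + a.
have gc : continuous g.
  by move=> s; apply: (@cvgD R); [exact: scalel_continuous|exact: cvg_cst].
pose M s := curv_mx h (normalize (g s)).
have Mc s : mx_continuous_at R _ _ _ M s.
  move=> i j; apply: (@continuous_comp _ _ _ g
    (fun y => curv_mx h (normalize y) i j)); first exact: gc.
  by apply: curv_mx_continuous; exact: seg.
have ns s : sphere (normalize (g s)) by apply: sphere_normalize; exact: seg.
have o1 : open [set s | posdef (M s)].
  by rewrite openE => s /= ps; exact: (posdef_near _ _ _ M s (Mc s) ps).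
have o2 : open [set s | ~ posdef (M s)].
  rewrite openE => s /= nps; have [v vs] := not_posdef_curv_mx _ (ns s) nps.
  have := mx_continuous_qform _ _ _ M v s (Mc s).
  move=> /cvgr_lt/(_ _ vs); apply: filterS => r rv pr.
  have [v0|v0] := eqVneq v 0; last by have := pr v v0; rewrite ltNge ltW.
  by move: rv; rewrite v0 /qform !mul0mx mxE ltxx.
have M0 : posdef (M 0) by rewrite /M /g scale0r add0r.
have BI : `[0, 1]%classic `&` [set s | posdef (M s)] = `[0, 1]%classic.
  apply: (@segment_connected R 0 1).
  - by exists 0; split => //=; rewrite in_itv/= lexx ler01.
  - by exists [set s | posdef (M s)].
  - exists (~` [set s | ~ posdef (M s)]); first exact: open_closedC.
    by congr (_ `&` _); apply/seteqP; split => s /=; [move=> ? ?|move/contrapT].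
have : `[0, 1]%classic (1 : R) by rewrite /= in_itv/= ler01 lexx.
by rewrite -BI => -[_]; rewrite /= /M /g scale1r subrK.
Qed.

(** When the line from [a] to [b] passes through 0, the path goes from [a] to a unit vector [c]
    orthogonal to both, then from [c] to [b]. *)
Lemma posdef_everywhere a : sphere a -> posdef (curv_mx h a) ->
  forall b, sphere b -> posdef (curv_mx h b).
Proof.
have nz (x : 'rV[R]_m.+1) : sphere x -> normalize x = x.
  by rewrite /normalize /sphere /= => ->; rewrite invr1 scale1r.
move=> as_ pa b bs.
have [E [EE Ea]] := sphere_frame a as_.
have [seg|/existsNP[s /negP]] :=
    pselect (forall s : R, s *: (b - a) + a != 0).
  by rewrite -(nz b bs); apply: (posdef_segment a) => //; rewrite nz.
rewrite negbK => /eqP sE.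
have [E' fE'] := sphere_frame b bs.
(* For [m = 0] the sphere is two points that no path joins, but its tangent spaces are trivial. *)
case: (posnP m) => [m0|m_gt0].
  apply/(posdef_curv_mx b E' bs fE') => v v0.
  by case/eqP: v0; apply/rowP => -[i i0]; exfalso; move: i0; rewrite /= m0.
pose c := row (Ordinal m_gt0) E.
have ca : c *m a^T = 0 by rewrite /c -row_mul Ea row0.
have cc : c *m c^T = 1%:M.
  rewrite /c -row_mul; apply/matrixP => i j; rewrite !ord1 !mxE.
  move/matrixP: EE => /(_ (Ordinal m_gt0) (Ordinal m_gt0)); rewrite !mxE eqxx => <-.
  by apply: eq_bigr => k _; rewrite !mxE.
have s0 : s != 0.
  apply: contra_neq (sphere_neq0 _ _ _ as_) => s0.
  by move: sE; rewrite s0 scale0r add0r.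
have bc : b *m c^T = 0.
  have ac : a *m c^T = 0 by rewrite -[LHS]trmxK trmx_mul trmxK ca trmx0.
  have : (s *: (b - a) + a) *m c^T = 0 by rewrite sE mul0mx.
  rewrite mulmxDl -scalemxAl mulmxBl ac subr0 addr0 => /eqP.
  by rewrite scaler_eq0 (negbTE s0) => /eqP.
have aa := sphere_mulmx _ _ a as_; have bb := sphere_mulmx _ _ b bs.
(* Pairing a zero of the line with [v] forces [r = 0], and then [u = 0]. *)
have line (u v : 'rV[R]_m.+1) : u *m u^T = 1%:M -> v *m v^T = 1%:M ->
    v *m u^T = 0 -> forall r : R, r *: (v - u) + u != 0.
  move=> uu vv vu r; apply/eqP => rE.
  have : (r *: (v - u) + u) *m v^T = 0 by rewrite rE mul0mx.
  have uv : u *m v^T = 0 by rewrite -[LHS]trmxK trmx_mul trmxK vu trmx0.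
  rewrite mulmxDl -scalemxAl mulmxBl uv vv subr0 addr0.
  move/matrixP/(_ 0 0); rewrite !mxE eqxx mulr1 => r0.
  move: rE; rewrite r0 scale0r add0r => u0.
  move/matrixP/(_ 0 0): uu; rewrite u0 mul0mx !mxE eqxx => /esym/eqP.
  by rewrite oner_eq0.
have pc : posdef (curv_mx h (normalize c)).
  by apply: (posdef_segment a); [exact: line|rewrite nz].
rewrite -(nz b bs); apply: (posdef_segment c) => //; exact: line.
Qed.
End Propagation.

(** * The radial profile and its normalizing constant *)

Lemma gprof_ge0 (R : realType) n (alpha q r : R) : 0 <= gprof n alpha q r.
Proof. by rewrite /gprof; case: ifP => _; rewrite ?expR_ge0 ?powR_ge0. Qed.

(** For [q < 0] the base increases with the radius and the exponent is negative; for [q > 0] the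
    base decreases and the exponent is positive. *)
Lemma gprof_decreasing (R : realType) n (alpha q r s : R) :
  0 < alpha -> q < alpha / (n%:R + alpha) -> 0 < r -> r < s ->
  0 < gprof n alpha q s -> gprof n alpha q s < gprof n alpha q r.
Proof.
move=> a0 qa r0 rs; have s0 := lt_trans r0 rs.
have n0 : 0 <= n%:R :> R by rewrite ler0n.
have ltp : r `^ alpha < s `^ alpha by rewrite gt0_ltr_powR// nnegrE ltW.
have rp0 := powR_gt0 alpha r0; have sp0 := powR_gt0 alpha s0.
rewrite /gprof; have [_|q0] := eqVneq q 0.
  by rewrite ltr_expR ltr_pM2r ?invr_gt0// ltrN2.
set e := q^-1 - _ - 1.
move: q0; rewrite neq_lt => /orP[q0|q0].
  have e0 : e < 0.
    rewrite /e subr_lt0 (lt_trans _ ltr01)// subr_lt0 (@lt_le_trans _ _ 0)//.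
      by rewrite invr_lt0.
    by rewrite divr_ge0// ltW.
  have qa0 : q / alpha < 0 by rewrite pmulr_llt0// invr_gt0.
  have br : 0 < 1 - q / alpha * r `^ alpha.
    by rewrite subr_gt0 (lt_trans _ ltr01)// nmulr_rlt0.
  have bs : 0 < 1 - q / alpha * s `^ alpha.
    by rewrite subr_gt0 (lt_trans _ ltr01)// nmulr_rlt0.
  rewrite (max_l (ltW br)) (max_l (ltW bs)) => _.
  rewrite -[e]opprK !(powRN _ (- e)) ltf_pV2 ?posrE ?powR_gt0//.
  rewrite gt0_ltr_powR ?oppr_gt0 ?nnegrE ?(ltW br) ?(ltW bs)//.
  by rewrite ltrD2l ltrN2 ltr_nM2l.
(* For positive [q], the bound on [q] says exactly that [q^-1] exceeds [n%:R / alpha + 1]. *)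
have e0 : 0 < e.
  have : (alpha / (n%:R + alpha))^-1 < q^-1.
    by rewrite ltf_pV2// posrE divr_gt0// ltr_wpDl.
  rewrite invf_div mulrDl mulfV ?gt_eqF// /e; lra.
have bsr : 1 - q / alpha * s `^ alpha < 1 - q / alpha * r `^ alpha.
  by rewrite ltrD2l ltrN2 ltr_pM2l// divr_gt0.
(* Outside the support the profile vanishes at [s], against its assumed positivity. This uses that
   [e] is nonzero, as zero to the power zero is 1. *)
have [bs|bs] := leP (1 - q / alpha * s `^ alpha) 0.
  by rewrite powR0 ?gt_eqF// ltxx.
have br := lt_trans bs bsr; rewrite (max_l (ltW br)) => _.
by rewrite gt0_ltr_powR// ?nnegrE ?(ltW br) ?(ltW bs).
Qed.

Lemma iint_ge0 (R : realType) (k : nat) (F : (nat -> R) -> \bar R) :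
  (forall y, (0 <= F y)%E) -> (0 <= iint k F)%E.
Proof.
elim: k F => [|k IH] F F0 /=; first exact: F0.
by apply: IH => y; apply: integral_ge0 => t _; exact: F0.
Qed.

(** [fine] sends an infinite integral to 0, so strict positivity is not claimed here; in
    [solution_le] it is read off from the equation. *)
Lemma Zc_ge0 (R : realType) n (alpha q : R) : 0 <= Zc n alpha q.
Proof.
by apply/fine_ge0/iint_ge0 => y; rewrite lee_fin gprof_ge0.
Qed.

(** * Positive definiteness of the curvature matrices *)

Lemma within_sphere_continuous (R : realType) n (F : 'rV[R]_n -> R) :
  (forall x, x != 0 -> {for x, continuous F}) -> {within @sphere R n, continuous F}.
Proof.
move=> Fc; apply: continuous_in_subspaceT => x; rewrite inE => xs.
by apply: Fc; exact: sphere_neq0 xs.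
Qed.

Lemma hom0_continuous (R : realType) n (h : 'rV[R]_n -> R) x :
  C2_sphere h -> x != 0 -> {for x, continuous (hom0 h)}.
Proof. by move=> hC /hC[d _]; exact: differentiable_continuous d. Qed.

Lemma qform_hess_mx (R : realType) n (h : 'rV[R]_n -> R) x (E : 'M[R]_(n.-1, n)) v :
  C2_sphere h -> x != 0 -> E *m E^T = 1%:M ->
  qform (hess_mx h x E) v =
  cov_hess h x (v *m E) (v *m E) + h x * (v *m v^T) 0 0.
Proof.
move=> hC x0 EE; rewrite hess_mxE// cov_hessE// /qform mulmxDr mulmxDl.
rewrite mul_mx_scalar -scalemxAl EE mulmxDr mulmxDl mxE; congr (_ + _).
  by rewrite trmx_mul !mulmxA.
by rewrite -scalemxAr mulmx1 -scalemxAl mxE.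
Qed.

Lemma hess_mx_sym (R : realType) n (h : 'rV[R]_n -> R) x (E : 'M[R]_(n.-1, n)) :
  C2_sphere h -> x != 0 -> E *m E^T = 1%:M ->
  (hess_mx h x E)^T = hess_mx h x E.
Proof.
move=> hC x0 EE; rewrite hess_mxE// !trmx_mul trmxK mulmxA.
by rewrite linearD /= tr_scalar_mx ambient_hess_sym.
Qed.

Section SphereMaximumPrinciple.
Variables (R : realType) (m : nat).
Implicit Types (h : 'rV[R]_m.+1 -> R).

Lemma sphere_nonempty : @sphere R m.+1 !=set0.
Proof.
exists (normalize (const_mx 1)); apply: sphere_normalize.
apply/eqP => /rowP/(_ 0); rewrite !mxE => /eqP; by rewrite oner_eq0.
Qed.

Lemma posdef_hess_mx h : C2_sphere h -> (forall x, sphere x -> 0 < h x) ->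
  (forall x E, sphere x -> tangent_frame x E -> \det (hess_mx h x E) != 0) ->
  forall x E, sphere x -> tangent_frame x E -> posdef (hess_mx h x E).
Proof.
move=> hC hpos hdet x E xs fE; apply/(posdef_curv_mx R m h hC x E xs fE).
have [a as_ amin] := @EVT_min_rV R m.+1 (hom0 h) _ sphere_nonempty
  (sphere_compact R m.+1) (within_sphere_continuous _ _ _
    (fun x => hom0_continuous _ _ h x hC)).
rewrite inE in as_; have a0 := sphere_neq0 _ _ a as_.
apply: (posdef_everywhere R m h hC hdet a) => //.
have [E' fE'] := sphere_frame R m a as_; have [EE _] := fE'.
apply/(posdef_curv_mx R m h hC a E' as_ fE') => v v0.
rewrite qform_hess_mx// ltr_wpDl//; last first.
  by rewrite mulr_gt0 ?hpos// -dotvE dotv_gt0.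
(* The constant [h a] touches [h] from below at the minimum point [a], so the covariant Hessian of
   [h] is nonnegative there. *)
have [||_] := hess_touch R m.+1 (fun=> h a) h 1 a (C2_cst R m.+1 (h a)) hC a0
    _ _ (v *m E').
- move=> y y0; rewrite mul1r -(hom0_sphere _ _ h a as_).
  have ys := sphere_normalize _ _ y y0.
  by rewrite -[hom0 h y](hom0_sphere _ _ h _ ys); apply: amin; rewrite inE.
- by rewrite mul1r [RHS]hom0_sphere.
rewrite mul1r; apply: le_trans; rewrite /cov_hess /hom0.
rewrite (_ : 'D__ _ = cst 0) ?derive_cst//.
by apply/funext => y; exact: derive_cst.
Qed.
End SphereMaximumPrinciple.

(** * Comparison of two solutions and uniqueness *)

Definition positive_solution {R : realType} {n : nat} (p alpha q : R)
    (f h : 'rV[R]_n -> R) : Prop :=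
  [/\ C2_sphere h, forall x, sphere x -> 0 < h x &
   forall x E, sphere x -> tangent_frame x E ->
     (h x) `^ (1 - p) * gdens alpha q (Dh h x) * \det (hess_mx h x E) = f x].

(** The numerical core of the comparison, used with [a] and [s] the powers of [t] with exponents
    [1 - p] and [m], with [g1], [g2] the profile values, and with [d], [D] the determinants. *)
Lemma scaled_product_lt (F : realFieldType) (a b z g1 g2 s d D : F) :
  0 < a -> 0 < b -> 0 < z -> 0 < g1 -> g1 < g2 -> 0 < D ->
  d <= s * D -> a * s <= 1 ->
  a * b * (z * g1) * d < b * (z * g2) * D.
Proof.
move=> a0 b0 z0 g10 g12 D0 dD as1.
apply: (@le_lt_trans _ _ (a * b * (z * g1) * (s * D))).
  by apply: ler_wpM2l dD; rewrite !mulr_ge0// ltW.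
rewrite [ltLHS](_ : _ = a * s * (b * (z * g1) * D)); last by ring.
apply: (@le_lt_trans _ _ (b * (z * g1) * D)).
  by apply: ler_piMl as1; rewrite !mulr_ge0// ltW.
by rewrite ltr_pM2r// !ltr_pM2l.
Qed.

Lemma solution_le (R : realType) (m : nat) (p alpha q : R)
    (f h1 h2 : 'rV[R]_m.+1 -> R) :
  m.+1%:R <= p -> 0 < alpha -> q < alpha / (m.+1%:R + alpha) ->
  (forall x, sphere x -> 0 < f x) ->
  positive_solution p alpha q f h1 ->
  positive_solution p alpha q f h2 ->
  forall x, sphere x -> h1 x <= h2 x.
Proof.
move=> np a0 qa fpos [C1 pos1 eq1] [C2 pos2 eq2].
have det1 x E : sphere x -> tangent_frame x E -> \det (hess_mx h1 x E) != 0.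
  move=> xs fE; apply: contraTneq (fpos x xs) => d0.
  by rewrite -(eq1 x E xs fE) d0 mulr0 ltxx.
have hom2 y : y != 0 -> 0 < hom0 h2 y.
  by move=> y0; apply: pos2; exact: sphere_normalize.
have Fc y : y != 0 -> {for y, continuous (fun z => hom0 h1 z / hom0 h2 z)}.
  move=> y0; apply: continuousM; first exact: hom0_continuous.
  by apply: continuousV; [rewrite gt_eqF ?hom2|exact: hom0_continuous].
have [x0 x0s x0max] := @EVT_max_rV R m.+1 _ _ (sphere_nonempty R m)
  (sphere_compact R m.+1) (within_sphere_continuous _ _ _ Fc).
rewrite inE in x0s; have x00 := sphere_neq0 _ _ _ x0s.
set t := hom0 h1 x0 / hom0 h2 x0 in x0max.
have t0 : 0 < t by rewrite divr_gt0 ?hom2// hom0_sphere// pos1.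
have touch : hom0 h1 x0 = t * hom0 h2 x0 by rewrite divfK// gt_eqF ?hom2.
have le12 y : sphere y -> h1 y <= t * h2 y.
  move=> ys; have := x0max y; rewrite inE !hom0_sphere// => /(_ ys).
  by rewrite ler_pdivrMr ?pos2.
have le12' y : y != 0 -> hom0 h1 y <= t * hom0 h2 y.
  by move=> y0; apply: le12; exact: sphere_normalize.
suff t1 : t <= 1.
  by move=> x xs; rewrite (le_trans (le12 x xs))// ler_piMl// ltW// pos2.
rewrite leNgt; apply/negP => t1.
have [E fE] := sphere_frame R m x0 x0s; have [EE _] := fE.
set W2 := hess_mx h2 x0 E.
have sym2 : W2^T = W2 by exact: hess_mx_sym.
have /andP[d1 d12] : 0 < \det (hess_mx h1 x0 E) <= \det (t *: W2).
  apply: posdef_det_le.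
  - exact: hess_mx_sym.
  - by rewrite linearZ /= sym2.
  - exact: posdef_hess_mx.
  move=> v; have -> : qform (t *: W2) v = t * qform W2 v.
    by rewrite /qform -scalemxAr -scalemxAl mxE.
  rewrite !qform_hess_mx// mulrDr lerD//.
    by have [] := hess_touch R m.+1 h1 h2 t x0 C1 C2 x00 le12' touch (v *m E).
  by move: touch; rewrite !hom0_sphere// => ->; rewrite mulrA.
(* The matrices have size [m], one less than the dimension, so the factor is [t ^+ m]. *)
rewrite detZ /= in d12.
have d2 : 0 < \det W2 by have := lt_le_trans d1 d12; rewrite pmulr_rgt0 ?exprn_gt0.
have DhE := Dh_touch R m.+1 h1 h2 t x0 C1 C2 x00 le12' touch.
have r0 := enorm_gt0 _ _ _ (Dh_neq0 R m.+1 h2 x0 C2 x0s (pos2 x0 x0s)).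
set r := enorm (Dh h2 x0) in r0.
have rr : enorm (Dh h1 x0) = t * r by rewrite DhE enormZ gtr0_norm.
have := eq1 x0 E x0s fE; have := eq2 x0 E x0s fE; rewrite -/W2.
rewrite !hom0_sphere// in touch.
rewrite /gdens rr -/r touch.
set Z := (Zc _ _ _)^-1; set g1 := gprof _ _ _ (t * r); set g2 := gprof _ _ _ r.
set H := h2 x0 in touch *; have H0 : 0 < H by exact: pos2.
set d := \det (hess_mx _ _ _) in d1 d12 *.
move=> e2 e1; have f0 := fpos x0 x0s.
have Z0 : 0 <= Z by rewrite invr_ge0 Zc_ge0.
(* Positivity of [f] keeps the gradient of [h1] inside the support of the profile. *)
have g10 : 0 < g1.
  rewrite lt_neqAle gprof_ge0 andbT eq_sym; apply: contraTneq f0 => g10.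
  by rewrite -e1 g10 mulr0 mulr0 mul0r ltxx.
have g12 : g1 < g2 by apply: gprof_decreasing; rewrite // ltr_pMl.
(* If [Zc] were 0 its inverse would be 0 too, and the equation would give [f x0 = 0]. *)
have Z1 : 0 < Z.
  rewrite lt_neqAle Z0 andbT eq_sym; apply: contraTneq f0 => Z00.
  by rewrite -e1 Z00 mul0r mulr0 mul0r ltxx.
(* The total exponent [1 - p + m] is at most 0 because [p] is at least the dimension [m.+1], and
   [t > 1]. *)
have tp : t `^ (1 - p) * t ^+ m <= 1.
  rewrite -powR_mulrn ?(ltW t0)// -powRD; last by rewrite (gt_eqF t0) implybT.
  rewrite -[leRHS](powRr0 t) ler_powR ?(ltW t1)//; move: np; rewrite -natr1; lra.
have Hp : 0 < H `^ (1 - p) by exact: powR_gt0.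
suff : f x0 < f x0 by rewrite ltxx.
have tp0 : 0 < t `^ (1 - p) by exact: powR_gt0.
rewrite -{1}e1 -e2 powRM; [|exact: ltW t0|exact: ltW H0].
exact: (scaled_product_lt _ _ _ _ _ _ _ _ _ tp0 Hp Z1 g10 g12 d2 d12 tp).
Qed.

Theorem theorem5p5 (R : realType) (n : nat) (p alpha q : R)
  (f h1 h2 : 'rV[R]_n -> R) :
  n%:R <= p -> 0 < alpha -> q < alpha / (n%:R + alpha) ->
  (forall x, sphere x -> 0 < f x) ->
  (forall h, h = h1 \/ h = h2 ->
     C2_sphere h /\
     (forall x, sphere x -> 0 < h x) /\
     (forall x E, sphere x -> tangent_frame x E ->
        (h x) `^ (1 - p) * gdens alpha q (Dh h x) * \det (hess_mx h x E)
        = f x)) ->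
  forall x, sphere x -> h1 x = h2 x.
Proof.
case: n f h1 h2 => [|m] f h1 h2 np a0 qa fpos sol x xs.
  (* In dimension 0 the sphere is empty, as the only vector is 0. *)
  by have := sphere_neq0 R 0 x xs; rewrite [x]thinmx0 eqxx.
have [C1 [pos1 eq1]] := sol h1 (or_introl erefl).
have [C2 [pos2 eq2]] := sol h2 (or_intror erefl).
by apply/eqP; rewrite eq_le; apply/andP; split;
  apply: (solution_le R m p alpha q f).
Qed.
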